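(* Let $\mathcal Q$ be a unary query on $p$-labelled graphs that is computable by a rational piecewise linear GNN. Then $\mathcal Q$ is definable in $\mathsf{GFO{+}C}$.
   Context: Graphs are finite, simple, undirected, with nonempty vertex set. A $p$-labelled graph is $(G,\mathbf b)$ with $\mathbf b:V(G)\to\{0,1\}^p$. A unary query $\mathcal Q$ assigns to each $(G,\mathbf b)$ a map $\mathcal Q(G,\mathbf b):V(G)\to\{0,1\}$, invariant under label-preserving isomorphisms. A dyadic rational is a rational whose denominator is a power of $2$. A piecewise linear function $L:\mathbb R\to\mathbb R$ (finitely many pieces) is rational if all thresholds, slopes and constant terms of its minimal representation are dyadic rationals. An FNN $\mathfrak F=(V,E,(\mathfrak a_v),(w_e),(b_v))$ has a finite dag skeleton, activations $\mathfrak a_v$, weights $w_e$, biases $b_v$; sources are inputs, sinks outputs; a non-input node computes $\mathfrak a_v(b_v+\sum_{uv\in E}w_{uv}\cdot\text{value}(u))$. It is rational piecewise linear if all weights and biases are dyadic rationals and all activations are continuous rational piecewise linear functions. A GNN layer $(\mathrm{msg},\mathrm{agg},\mathrm{comb})$, with $\mathrm{msg},\mathrm{comb}$ computed by FNNs and $\mathrm{agg}\in\{$sum, mean, max$\}$ (coordinatewise, $\mathbf 0$ on empty multisets), maps $\mathcal x:V(G)\to\mathbb R^p$ to $\mathcal y(v)=\mathrm{comb}(\mathcal x(v),\mathrm{agg}\{\!\{\mathrm{msg}(\mathcal x(v),\mathcal x(w)):w\in N(v)\}\!\})$. A GNN is a finite composition of layers; $\tilde{\mathfrak N}(G,\mathcal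 x)$ is its output signal. It is rational piecewise linear if all its FNNs are. A GNN $\mathfrak N$ (input dimension $p$, output dimension $1$) computes $\mathcal Q$ if for all $(G,\mathbf b)$ and $v$: $\tilde{\mathfrak N}(G,\mathbf b)(v)\ge3/4$ if $\mathcal Q(G,\mathbf b)(v)=1$ and $\le1/4$ if $\mathcal Q(G,\mathbf b)(v)=0$. Logic: $(G,\mathbf b)$ is the structure with universe $V(G)$, binary $E$, unary $P_i=\{v:\mathbf b(v)_i=1\}$. Two sorts: vertex variables (over $V(G)$) and number variables (over $\mathbb N$). $\mathsf{GFO{+}C}$ uses only vertex variables $x_1,x_2$. Terms: number variables, $0$, $1$, $\mathrm{ord}$ (value $|V(G)|$), $\theta+\theta'$, $\theta\cdot\theta'$, counting terms. Formulas: $\theta\le\theta'$, $E(x_i,x_j)$, $P_k(x_i)$, $x_i=x_j$, $\neg\varphi$, $\varphi\wedge\psi$. Counting terms: $\#(x_{3-i},y_1<\theta_1,\dots,y_k<\theta_k).(\gamma\wedge\varphi)$ with guard $\gamma$ equal to $E(x_i,x_{3-i})$ or $E(x_{3-i},x_i)$, and $\#(y_1<\theta_1,\dots,y_k<\theta_k).\varphi$. A counting term $\#(z_1..z_m,y_1<\theta_1,..,y_k<\theta_k).\psi$ evaluates to the number of tuples $(c_1..c_m,b_1..b_k)$ of vertices and naturals with each $b_j$ below the value of $\theta_j$ under the assignment extended by $z\mapsto c$, $y_1..y_{j-1}\mapsto b_1..b_{j-1}$, and satisfying $\psi$ under the assignment extended by all of them (these variables become bound). $\mathcal Q$ is definable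 in $\mathsf{GFO{+}C}$ if there is a formula $\varphi(x_1)$ with only free variable $x_1$ such that $(G,\mathbf b)\models\varphi(v)\iff\mathcal Q(G,\mathbf b)(v)=1$ for all $(G,\mathbf b),v$. *)

(* Defs.v *)
From Stdlib Require Import Reals ZArith.
From mathcomp Require Import all_boot.

Delimit Scope R_scope with Re.

Set Implicit Arguments.
Unset Strict Implicit.
Unset Printing Implicit Defensive.

(* A finite, simple, undirected graph with nonempty vertex set.
   Vertices are {0, ..., gn-1} (every finite graph is isomorphic to one). *)
Record graph := Graph {
  gn : nat;
  gE : rel 'I_gn;
  gE_sym : symmetric gE;
  gE_irr : irreflexive gE;
  gn_pos : (0 < gn)%N }.
Arguments gE : clear implicits.

Definition labelling (p : nat) (G : graph) := 'I_(gn G) -> p.-tuple bool.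

Definition query (p : nat) := forall G : graph, labelling p G -> 'I_(gn G) -> bool.

Definition query_invariant (p : nat) (Q : query p) : Prop :=
  forall (G H : graph) (bG : labelling p G) (bH : labelling p H)
         (f : 'I_(gn G) -> 'I_(gn H)),
    bijective f ->
    (forall x y, gE H (f x) (f y) = gE G x y) ->
    (forall x, bH (f x) = bG x) ->
    forall v, Q H bH (f v) = Q G bG v.

Definition dyadic (x : R) : Prop :=
  exists (z : Z) (k : nat), x = (IZR z / 2 ^ k)%Re.

(* A representation of f with m thresholds t 0 < ... < t (m-1) and m+1
   affine pieces x |-> a i * x + c i, piece i living on [t (i-1), t i]
   (unbounded to the left for i = 0 and to the right for i = m).
   Adjacent pieces are distinct, i.e. the representation is minimal. *)
Definition pl_minimal_repr (f : R -> R) (m : nat) (t a c : nat -> R) : Prop :=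
  (forall i, (i.+1 < m)%N -> (t i < t i.+1)%Re) /\
  (forall i, (i < m)%N -> (a i, c i) <> (a i.+1, c i.+1)) /\
  (forall i (x : R), (i <= m)%N ->
     (i = 0%N \/ (t i.-1 <= x)%Re) -> (i = m \/ (x <= t i)%Re) ->
     f x = (a i * x + c i)%Re).

Definition cont_rat_pl (f : R -> R) : Prop :=
  continuity f /\
  exists (m : nat) (t a c : nat -> R),
    pl_minimal_repr f m t a c /\
    (forall i, (i < m)%N -> dyadic (t i)) /\
    (forall i, (i <= m)%N -> dyadic (a i) /\ dyadic (c i)).

(* Nodes are 0 .. fn_size-1, numbered in a topological order of the dag
   (edges go from smaller to larger nodes); nodes 0 .. fn_nin-1 are the
   input nodes (in this order); fn_outnode 0 .. fn_outnode (fn_nout-1)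
   enumerates the output nodes (the sinks). Vectors in R^k are
   represented as functions nat -> R, only the first k entries matter. *)
Record fnn := FNN {
  fn_size : nat;
  fn_nin : nat;
  fn_nout : nat;
  fn_edge : nat -> nat -> bool;
  fn_w : nat -> nat -> R;
  fn_b : nat -> R;
  fn_act : nat -> R -> R;
  fn_outnode : nat -> nat }.

Definition fnn_wf (F : fnn) : Prop :=
  (fn_nin F <= fn_size F)%N /\
  (forall u v, fn_edge F u v ->
     [/\ (u < v)%N, (fn_nin F <= v)%N & (v < fn_size F)%N]) /\
  (forall v, (fn_nin F <= v)%N -> (v < fn_size F)%N -> exists u, fn_edge F u v) /\
  (forall j, (j < fn_nout F)%N ->
     (fn_outnode F j < fn_size F)%N /\ (forall w, ~~ fn_edge F (fn_outnode F j) w)) /\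
  (forall j k, (j < fn_nout F)%N -> (k < fn_nout F)%N ->
     fn_outnode F j = fn_outnode F k -> j = k) /\
  (forall v, (v < fn_size F)%N -> (forall w, ~~ fn_edge F v w) ->
     exists j, (j < fn_nout F)%N /\ fn_outnode F j = v).

Fixpoint sumR (n : nat) (f : nat -> R) : R :=
  match n with 0 => 0%Re | S n' => (sumR n' f + f n')%Re end.

Fixpoint fnn_vals (F : fnn) (x : nat -> R) (k : nat) : nat -> R :=
  match k with
  | 0 => fun _ => 0%Re
  | S k' =>
      let prev := fnn_vals F x k' in
      fun v =>
        if v == k' then
          (if (k' < fn_nin F)%N then x k'
           else fn_act F k'
                  (fn_b F k' +
                   sumR k' (fun u => if fn_edge F u k' then (fn_w F u k' * prev u)%Re
                                     else 0%Re))%Re)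
        else prev v
  end.

Definition fnn_eval (F : fnn) (x : nat -> R) : nat -> R :=
  fun j => fnn_vals F x (fn_size F) (fn_outnode F j).

Definition fnn_rat_pl (F : fnn) : Prop :=
  (forall u v, fn_edge F u v -> dyadic (fn_w F u v)) /\
  (forall v, (fn_nin F <= v)%N -> (v < fn_size F)%N ->
     dyadic (fn_b F v) /\ cont_rat_pl (fn_act F v)).

Inductive aggr := AggSum | AggMean | AggMax.

Definition aggregate (ag : aggr) (ms : seq (nat -> R)) : nat -> R :=
  fun i =>
    match ag with
    | AggSum => foldr (fun m acc => (m i + acc)%Re) 0%Re ms
    | AggMean =>
        match ms with
        | [::] => 0%Re
        | _ => (foldr (fun m acc => (m i + acc)%Re) 0%Re ms / INR (size ms))%Re
        end
    | AggMax =>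
        match ms with
        | [::] => 0%Re
        | m0 :: ms' => foldr (fun m acc => Rmax (m i) acc) (m0 i) ms'
        end
    end.

Definition vcat (p : nat) (a b : nat -> R) : nat -> R :=
  fun i => if (i < p)%N then a i else b (i - p)%N.

Record layer := Layer {
  ly_in : nat;
  ly_msg : fnn;
  ly_agg : aggr;
  ly_comb : fnn }.

Definition ly_out (l : layer) : nat := fn_nout (ly_comb l).

Definition layer_wf (l : layer) : Prop :=
  fnn_wf (ly_msg l) /\ fnn_wf (ly_comb l) /\
  fn_nin (ly_msg l) = (2 * ly_in l)%N /\
  fn_nin (ly_comb l) = (ly_in l + fn_nout (ly_msg l))%N.

Definition layer_apply (l : layer) (G : graph) (x : 'I_(gn G) -> nat -> R)
  : 'I_(gn G) -> nat -> R :=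
  fun v =>
    fnn_eval (ly_comb l)
      (vcat (ly_in l) (x v)
         (aggregate (ly_agg l)
            (map (fun w => fnn_eval (ly_msg l) (vcat (ly_in l) (x v) (x w)))
                 (filter (fun w => gE G v w) (enum 'I_(gn G)))))).

Definition gnn := seq layer.

Fixpoint gnn_wf (N : gnn) (p q : nat) : Prop :=
  match N with
  | [::] => p = q
  | l :: N' => ly_in l = p /\ layer_wf l /\ gnn_wf N' (ly_out l) q
  end.

Definition gnn_rat_pl (N : gnn) : Prop :=
  forall l, List.In l N -> fnn_rat_pl (ly_msg l) /\ fnn_rat_pl (ly_comb l).

Fixpoint gnn_apply (N : gnn) (G : graph) (x : 'I_(gn G) -> nat -> R)
  : 'I_(gn G) -> nat -> R :=
  match N with
  | [::] => x
  | l :: N' => gnn_apply N' (layer_apply l x)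
  end.

Definition lab_signal (p : nat) (G : graph) (b : labelling p G)
  : 'I_(gn G) -> nat -> R :=
  fun v i => if nth false (b v) i then 1%Re else 0%Re.

Definition gnn_computes (p : nat) (N : gnn) (Q : query p) : Prop :=
  forall (G : graph) (b : labelling p G) (v : 'I_(gn G)),
    (Q G b v -> (3 / 4 <= gnn_apply N (lab_signal b) v 0%N)%Re) /\
    (~~ Q G b v -> (gnn_apply N (lab_signal b) v 0%N <= 1 / 4)%Re).

(* Vertex variables: false = x1, true = x2.  Number variables: y_n, n : nat.
   Label predicates P_1..P_p are indexed by 'I_p (P_{k+1} ~ k). *)
Inductive term (p : nat) : Type :=
  | TVar (y : nat)
  | TZero
  | TOne
  | TOrd
  | TAdd (t1 t2 : term p)
  | TMul (t1 t2 : term p)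
  (* #(x_{3-i}, y1<θ1,..,yk<θk).(γ ∧ φ) with γ = E(x_i,x_{3-i}) if rev = false,
     γ = E(x_{3-i},x_i) if rev = true; the bounds and φ are in bs *)
  | TCntG (i : bool) (rev : bool) (bs : bounds p)
  (* #(y1<θ1,..,yk<θk).φ *)
  | TCnt (bs : bounds p)
with bounds (p : nat) : Type :=
  | BEnd (phi : form p)
  | BCons (y : nat) (t : term p) (rest : bounds p)
with form (p : nat) : Type :=
  | FLe (t1 t2 : term p)
  | FEdge (i j : bool)
  | FLab (k : 'I_p) (i : bool)
  | FEqV (i j : bool)
  | FNot (f : form p)
  | FAnd (f g : form p).

Arguments TVar {p}. Arguments TZero {p}. Arguments TOne {p}. Arguments TOrd {p}.
Arguments TAdd {p}. Arguments TMul {p}. Arguments TCntG {p}. Arguments TCnt {p}.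
Arguments BEnd {p}. Arguments BCons {p}.
Arguments FLe {p}. Arguments FEdge {p}. Arguments FLab {p}. Arguments FEqV {p}.
Arguments FNot {p}. Arguments FAnd {p}.

Definition vupd (G : graph) (va : bool -> 'I_(gn G)) (j : bool) (c : 'I_(gn G))
  : bool -> 'I_(gn G) := fun k => if k == j then c else va k.

Definition nupd (na : nat -> nat) (y m : nat) : nat -> nat :=
  fun z => if z == y then m else na z.

Fixpoint sumN (n : nat) (f : nat -> nat) : nat :=
  match n with 0 => 0%N | S n' => (sumN n' f + f n')%N end.

Fixpoint eval_t (p : nat) (G : graph) (b : labelling p G) (t : term p)
  (va : bool -> 'I_(gn G)) (na : nat -> nat) {struct t} : nat :=
  match t with
  | TVar y => na y
  | TZero => 0%N
  | TOne => 1%N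
  | TOrd => gn G
  | TAdd t1 t2 => (eval_t b t1 va na + eval_t b t2 va na)%N
  | TMul t1 t2 => (eval_t b t1 va na * eval_t b t2 va na)%N
  | TCntG i rev bs =>
      sumn (map (fun c =>
                   if (if rev then gE G c (va i) else gE G (va i) c)
                   then eval_b b bs (vupd va (~~ i) c) na else 0%N)
                (enum 'I_(gn G)))
  | TCnt bs => eval_b b bs va na
  end
with eval_b (p : nat) (G : graph) (b : labelling p G) (bs : bounds p)
  (va : bool -> 'I_(gn G)) (na : nat -> nat) {struct bs} : nat :=
  match bs with
  | BEnd phi => nat_of_bool (eval_f b phi va na)
  | BCons y t rest => sumN (eval_t b t va na) (fun m => eval_b b rest va (nupd na y m))
  end
with eval_f (p : nat) (G : graph) (b : labelling p G) (phi : form p)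
  (va : bool -> 'I_(gn G)) (na : nat -> nat) {struct phi} : bool :=
  match phi with
  | FLe t1 t2 => (eval_t b t1 va na <= eval_t b t2 va na)%N
  | FEdge i j => gE G (va i) (va j)
  | FLab k i => tnth (b (va i)) k
  | FEqV i j => va i == va j
  | FNot f => ~~ eval_f b f va na
  | FAnd f g => eval_f b f va na && eval_f b g va na
  end.

Fixpoint free_x_t (p : nat) (j : bool) (t : term p) : bool :=
  match t with
  | TVar _ | TZero | TOne | TOrd => false
  | TAdd t1 t2 | TMul t1 t2 => free_x_t j t1 || free_x_t j t2
  | TCntG i _ bs => (j == i) || ((j != ~~ i) && free_x_b j bs)
  | TCnt bs => free_x_b j bs
  end
with free_x_b (p : nat) (j : bool) (bs : bounds p) : bool :=
  match bs with
  | BEnd phi => free_x_f j phi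
  | BCons _ t rest => free_x_t j t || free_x_b j rest
  end
with free_x_f (p : nat) (j : bool) (phi : form p) : bool :=
  match phi with
  | FLe t1 t2 => free_x_t j t1 || free_x_t j t2
  | FEdge i k | FEqV i k => (j == i) || (j == k)
  | FLab _ i => j == i
  | FNot f => free_x_f j f
  | FAnd f g => free_x_f j f || free_x_f j g
  end.

Fixpoint free_y_t (p : nat) (y : nat) (t : term p) : bool :=
  match t with
  | TVar z => y == z
  | TZero | TOne | TOrd => false
  | TAdd t1 t2 | TMul t1 t2 => free_y_t y t1 || free_y_t y t2
  | TCntG _ _ bs | TCnt bs => free_y_b y bs
  end
with free_y_b (p : nat) (y : nat) (bs : bounds p) : bool :=
  match bs with
  | BEnd phi => free_y_f y phi
  | BCons z t rest => free_y_t y t || ((y != z) && free_y_b y rest)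
  end
with free_y_f (p : nat) (y : nat) (phi : form p) : bool :=
  match phi with
  | FLe t1 t2 => free_y_t y t1 || free_y_t y t2
  | FEdge _ _ | FEqV _ _ | FLab _ _ => false
  | FNot f => free_y_f y f
  | FAnd f g => free_y_f y f || free_y_f y g
  end.

Definition gfoc_definable (p : nat) (Q : query p) : Prop :=
  exists phi : form p,
    ~~ free_x_f true phi /\ (forall y, ~~ free_y_f y phi) /\
    forall (G : graph) (b : labelling p G) (v : 'I_(gn G))
           (va : bool -> 'I_(gn G)) (na : nat -> nat),
      va false = v -> eval_f b phi va na = Q G b v.

(* Main.v *)
(* All values computed by the network on a graph of order n are polynomially
   bounded in n, and every operation it performs is Lipschitz with a constant
   polynomial in n.  So it suffices to compute with fixed-point approximations
   (P - N) / D, where P, N are terms and D is a closed term, both of polynomial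
   (unary) size, and where the error can be made smaller than 1 / A for any
   prescribed closed term A.  Continuous piecewise linear activations are
   linear combinations of shifted ReLUs; everything except the division in a
   mean (whose denominator, the degree, depends on the vertex) is exact.
   Without rounding, nested means would produce exponentially large common
   denominators. *)
Require Import Defs.
From Stdlib Require Import Reals Lra Lia FunctionalExtensionality.
From mathcomp Require Import all_boot.

Set Implicit Arguments.
Unset Strict Implicit.
Unset Printing Implicit Defensive.

(* Dependence of values on the free variables *)
Scheme term_mut := Induction for term Sort Prop
  with bounds_mut := Induction for bounds Sort Prop
  with form_mut := Induction for form Sort Prop.
Combined Scheme syntax_mutind from term_mut, bounds_mut, form_mut.

Section Coincidence.
Variables (p : nat) (G : graph) (b : labelling p G).

Lemma eq_sumN n f g : (forall i, f i = g i) -> sumN n f = sumN n g.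
Proof. by move=> fg; elim: n => //= n ->; rewrite fg. Qed.

(** In the binder cases both sides give the bound variable the same value, so agreement on the other
    free variables is enough. *)
Lemma eval_coincidence :
  (forall (t : term p) va va' na na',
     (forall j, free_x_t j t -> va j = va' j) ->
     (forall y, free_y_t y t -> na y = na' y) ->
     eval_t b t va na = eval_t b t va' na') /\
  (forall (bs : bounds p) va va' na na',
     (forall j, free_x_b j bs -> va j = va' j) ->
     (forall y, free_y_b y bs -> na y = na' y) ->
     eval_b b bs va na = eval_b b bs va' na') /\
  (forall (phi : form p) va va' na na',
     (forall j, free_x_f j phi -> va j = va' j) ->
     (forall y, free_y_f y phi -> na y = na' y) ->
     eval_f b phi va na = eval_f b phi va' na').
Proof.
apply: syntax_mutind => //=.
- by move=> y va va' na na' _; apply.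
- move=> t IHt u IHu va va' na na' X Y.
  by congr (_ + _)%N; [apply: IHt|apply: IHu] => z Hz;
    (apply: X || apply: Y); rewrite Hz ?orbT.
- move=> t IHt u IHu va va' na na' X Y.
  by congr (_ * _)%N; [apply: IHt|apply: IHu] => z Hz;
    (apply: X || apply: Y); rewrite Hz ?orbT.
- move=> i rev bs IH va va' na na' X Y.
  rewrite (X i) ?eqxx //; congr sumn; apply: eq_map => c.
  rewrite (IH _ (vupd va' (~~ i) c) na na') // => j Hj.
  by rewrite /vupd; case: eqP => // ji; apply: X; rewrite Hj andbT (introN eqP ji) orbT.
- by move=> phi IH va va' na na' X Y; rewrite (IH va va' na na').
- move=> y t IHt bs IHb va va' na na' X Y.
  rewrite (IHt va va' na na'); first last.
  + by move=> z Hz; apply: Y; rewrite Hz.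
  + by move=> z Hz; apply: X; rewrite Hz.
  apply: eq_sumN => m; apply: IHb => z Hz; first by apply: X; rewrite Hz orbT.
  by rewrite /nupd; case: eqP => // yz; apply: Y; rewrite Hz andbT (introN eqP yz) orbT.
- move=> t IHt u IHu va va' na na' X Y.
  by congr (_ <= _)%N; [apply: IHt|apply: IHu] => z Hz;
    (apply: X || apply: Y); rewrite Hz ?orbT.
- by move=> i j va va' na na' X _; rewrite !X ?eqxx ?orbT.
- by move=> k i va va' na na' X _; rewrite X.
- by move=> i j va va' na na' X _; rewrite !X ?eqxx ?orbT.
- by move=> f IH va va' na na' X Y; rewrite (IH va va' na na').
- move=> t IHt u IHu va va' na na' X Y.
  by congr (_ && _); [apply: IHt|apply: IHu] => z Hz;
    (apply: X || apply: Y); rewrite Hz ?orbT.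
Qed.

End Coincidence.

(** Terms get their values by counting an initial segment: any bound [n >= m] will do, once a
    formula expresses [y < m]. *)
Lemma sumN_ltn n m (P : pred nat) :
  (m <= n)%N -> (forall y, (y < n)%N -> P y = (y < m)%N) ->
  sumN n (fun y => nat_of_bool (P y)) = m.
Proof.
move=> mn Pm; rewrite -[RHS](minn_idPl mn) {mn}.
elim: n Pm => [|n IH] Pm /=; first by rewrite minn0.
rewrite IH => [|y yn]; last exact/Pm/leqW.
rewrite Pm // addnC; case: (leqP m n) => nm; first by rewrite (minn_idPl (leqW nm)).
by rewrite (minn_idPr nm).
Qed.

Lemma sumn_filter T (a : pred T) (F : T -> nat) s :
  sumn [seq (if a c then F c else 0) | c <- s] = sumn [seq F c | c <- s & a c].
Proof. by elim: s => //= c s ->; case: (a c). Qed.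

(** * Derived terms: arithmetic and aggregation over neighbours *)

Section Terms.
Variable p : nat.
Implicit Types (X : pred bool) (t u : term p).

(** Free number variables are excluded, so all derived terms can bind number variable 0 without
    capturing anything in their operands. *)
Definition over X t : Prop :=
  (forall j, free_x_t j t -> X j) /\ (forall y, free_y_t y t = false).

Lemma over_eval X t : over X t ->
  forall G (b : labelling p G) va va' na na',
  (forall j, X j -> va j = va' j) -> eval_t b t va na = eval_t b t va' na'.
Proof.
case=> Xt Yt G b va va' na na' H; apply: (eval_coincidence b).1 => [j /Xt|y].
  exact: H.
by rewrite Yt.
Qed.

Lemma over_closed t : over pred0 t ->
  forall G (b : labelling p G) va va' na na',
  eval_t b t va na = eval_t b t va' na'.
Proof. by move=> ot *; apply: (over_eval ot). Qed.

Lemma over_sub X X' t : subpred X X' -> over X t -> over X' t.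
Proof. by move=> XX' [Xt Yt]; split=> // j /Xt/XX'. Qed.

Lemma over_closed_sub X t : over pred0 t -> over X t.
Proof. exact: over_sub. Qed.

Lemma over1 X : over X TOne. Proof. by []. Qed.
Lemma over_ord X : over X TOrd. Proof. by []. Qed.

Lemma over_add X t u : over X t -> over X u -> over X (TAdd t u).
Proof.
by move=> [Xt Yt] [Xu Yu]; split=> [j /= /orP[/Xt|/Xu]|y] //=; rewrite Yt Yu.
Qed.

Lemma over_mul X t u : over X t -> over X u -> over X (TMul t u).
Proof.
by move=> [Xt Yt] [Xu Yu]; split=> [j /= /orP[/Xt|/Xu]|y] //=; rewrite Yt Yu.
Qed.

Fixpoint tnat n : term p := if n is n'.+1 then TAdd (tnat n') TOne else TZero.

Lemma over_nat X n : over X (tnat n).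
Proof. by elim: n => //= n IH; exact: over_add. Qed.

Lemma eval_nat G (b : labelling p G) va na n : eval_t b (tnat n) va na = n.
Proof. by elim: n => //= n ->; rewrite addn1. Qed.

Definition tcount t phi : term p := TCnt (BCons 0 t (BEnd phi)).

Definition tsub t u := tcount t (FLe (TAdd (TAdd (TVar 0) TOne) u) t).

(** For [u > 0], [y < t %/ u] means [(y + 1) * u <= t]; the conjunct [1 <= u] gives the value 0 when
    [u = 0], as for [%/]. *)
Definition tdiv t u :=
  tcount t (FAnd (FLe TOne u) (FLe (TMul (TAdd (TVar 0) TOne) u) t)).

Lemma over_tsub X t u : over X t -> over X u -> over X (tsub t u).
Proof.
move=> [Xt Yt] [Xu Yu]; split=> [j /=|y /=].
  by case/or3P => [/Xt|/Xu|/Xt].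
by rewrite !Yt !Yu !orbF /=; case: eqP.
Qed.

Lemma over_tdiv X t u : over X t -> over X u -> over X (tdiv t u).
Proof.
move=> [Xt Yt] [Xu Yu]; split=> [j /=|y /=].
  by case/or4P => [/Xt|/Xu|/Xu|/Xt].
by rewrite !Yt !Yu !orbF /=; case: eqP.
Qed.

Lemma eval_tsub X t u : over X t -> over X u ->
  forall G (b : labelling p G) va na,
  eval_t b (tsub t u) va na = (eval_t b t va na - eval_t b u va na)%N.
Proof.
move=> ot ou G b va na /=.
apply: (@sumN_ltn _ _ (fun y => _)) => [|y _]; first exact: leq_subr.
rewrite (over_eval ot (va' := va) b _ na) //.
by rewrite (over_eval ou (va' := va) b _ na) // /nupd eqxx addn1 ltn_subRL addnC addnS.
Qed.

Lemma eval_tdiv X t u : over X t -> over X u ->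
  forall G (b : labelling p G) va na,
  eval_t b (tdiv t u) va na = (eval_t b t va na %/ eval_t b u va na)%N.
Proof.
move=> ot ou G b va na /=.
apply: (@sumN_ltn _ _ (fun y => _)) => [|y _]; first exact: leq_div.
rewrite (over_eval ot (va' := va) b _ na) //.
rewrite (over_eval ou (va' := va) b _ na) // /nupd eqxx addn1.
by case: posnP => [->|u0]; rewrite ?divn0 //= leq_divRL.
Qed.

Definition nbrs (G : graph) (v : 'I_(gn G)) := [seq w <- enum 'I_(gn G) | gE G v w].

Lemma eval_TCntG i bs G (b : labelling p G) va na :
  eval_t b (TCntG i false bs) va na =
  sumn [seq eval_b b bs (vupd va (~~ i) w) na | w <- nbrs (va i)].
Proof. exact: sumn_filter. Qed.

(** With a formula that is always true, the count is over pairs of a neighbour and a number below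
    the value of [t] there. *)
Definition tnbr_sum i t : term p :=
  TCntG i false (BCons 0 t (BEnd (FLe TZero TZero))).

Lemma over_nbr_sum i t : over predT t -> over (pred1 i) (tnbr_sum i t).
Proof.
case=> _ Yt; split=> [j|y] /=; last by rewrite Yt andbF.
by case: j; case: i.
Qed.

Lemma eval_nbr_sum i t G (b : labelling p G) va na :
  eval_t b (tnbr_sum i t) va na =
  sumn [seq eval_t b t (vupd va (~~ i) w) na | w <- nbrs (va i)].
Proof.
rewrite eval_TCntG; congr sumn; apply: eq_map => w.
exact: (@sumN_ltn _ _ xpredT).
Qed.

(* The largest value of [t - u + B] over the neighbours, where [B], the sum of
   [u] over all neighbours, makes the truncated subtraction exact; it is
   computed as the number of [y] lying below one of these values. *)
Definition tnbr_max i t u : term p :=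
  let B := tnbr_sum i u in
  tcount (TAdd (tnbr_sum i t) B)
    (FLe TOne (TCntG i false (BEnd (FLe (TAdd (TAdd (TVar 0) TOne) u) (TAdd t B))))).

Lemma over_nbr_max i t u :
  over predT t -> over predT u -> over (pred1 i) (tnbr_max i t u).
Proof.
move=> [_ Yt] [_ Yu]; split=> [j /=|y /=].
  by case: j; case: i; rewrite /= ?andbF.
by rewrite !Yt !Yu !andbF !orbF /=; case: eqP.
Qed.

Definition max_seq (s : seq nat) := if s is n :: s' then foldr maxn n s' else 0.

Lemma ltn_max_seq y s : (y < max_seq s)%N = has (fun n => (y < n)%N) s.
Proof.
case: s => //= n s; elim: s => [|m s IH] /=; first by rewrite orbF.
by rewrite leq_max IH orbCA.
Qed.

Lemma eval_nbr_max i t u : over predT t -> over predT u ->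
  forall G (b : labelling p G) va na,
  eval_t b (tnbr_max i t u) va na =
  max_seq [seq (eval_t b t (vupd va (~~ i) w) na + eval_t b (tnbr_sum i u) va na
                - eval_t b u (vupd va (~~ i) w) na)%N | w <- nbrs (va i)].
Proof.
move=> ot ou G b va na.
set B := eval_t b (tnbr_sum i u) va na.
pose h w := (eval_t b t (vupd va (~~ i) w) na + B
             - eval_t b u (vupd va (~~ i) w) na)%N.
pose K := (eval_t b (tnbr_sum i t) va na + B)%N.
pose phi := FLe (TAdd (TAdd (TVar 0) TOne) u) (TAdd t (tnbr_sum i u)).
change (sumN K (fun y => nat_of_bool
  (1 <= eval_t b (TCntG i false (BEnd phi)) va (nupd na 0 y)))
  = max_seq [seq h w | w <- nbrs (va i)]).
apply: (@sumN_ltn _ _ (fun y => _)) => [|y _]; last first.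
  rewrite ltn_max_seq has_map has_count -sumn_count eval_TCntG; congr (0 < sumn _).
  apply: eq_map => w; congr nat_of_bool.
  change ((nupd na 0 y 0 + 1 + eval_t b u (vupd va (~~ i) w) (nupd na 0 y)
    <= eval_t b t (vupd va (~~ i) w) (nupd na 0 y) +
       eval_t b (tnbr_sum i u) (vupd va (~~ i) w) (nupd na 0 y)) = (y < h w)).
  rewrite (over_eval ot (va' := vupd va (~~ i) w) b _ na) //.
  rewrite (over_eval ou (va' := vupd va (~~ i) w) b _ na) //.
  (* The shift occurs in the scope of the bound neighbour variable, but only the other vertex
     variable is free in it. *)
  rewrite (over_eval (over_nbr_sum i ou) (va' := va) b _ na) -/B.
    by rewrite /nupd eqxx addn1 ltn_subRL addnC addnS.
  by move=> j /eqP->; rewrite /vupd; case: (i).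
rewrite leqNgt ltn_max_seq; apply/hasPn => _ /mapP[w ws ->]; rewrite -leqNgt.
apply: leq_trans (leq_subr _ _) _; rewrite leq_add2r eval_nbr_sum.
by rewrite sumnE big_map (big_rem w) //= leq_addr.
Qed.

End Terms.

(** * Exact fixed-point representations *)

Section Approximation.
Local Open Scope R_scope.
Variable p : nat.
Implicit Types (X : pred bool) (t : term p).

Definition real_expr := forall G : graph, labelling p G -> (bool -> 'I_(gn G)) -> R.
Implicit Types f g u : real_expr.

Lemma INR_addn m n : INR (m + n)%N = INR m + INR n.
Proof. exact: plus_INR. Qed.

Lemma INR_muln m n : INR (m * n)%N = INR m * INR n.
Proof. exact: mult_INR. Qed.

Lemma INR_subn m n : (n <= m)%N -> INR (m - n)%N = INR m - INR n.
Proof. by move=> nm; rewrite -[in RHS](subnK nm) INR_addn; lra. Qed.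

Lemma INR_leq m n : (m <= n)%N -> INR m <= INR n.
Proof. by move=> /leP; exact: le_INR. Qed.

Lemma INR_gt0 n : (0 < n)%N -> 0 < INR n.
Proof. by move=> /ltP; exact: lt_0_INR. Qed.

Lemma INR_divn_bounds m n : (0 < n)%N ->
  INR (m %/ n) * INR n <= INR m < (INR (m %/ n) + 1) * INR n.
Proof.
move=> n0; split; first by rewrite -INR_muln; exact/INR_leq/leq_trunc_div.
have -> : 1 = INR 1 by [].
by rewrite -INR_addn -INR_muln addn1; apply/lt_INR/ltP; exact: ltn_ceil.
Qed.

(** Two numerators provide signs. The denominator is closed, hence the same at all vertices, so sums
    and maxima over neighbours act on the numerators alone. *)
Definition rep X u : Prop := exists P N D,
  [/\ over X P, over X N, over pred0 D &
   forall G (b : labelling p G) va na, (0 < eval_t b D va na)%N /\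
     u G b va = (INR (eval_t b P va na) - INR (eval_t b N va na))
                / INR (eval_t b D va na)].

(** As [A] is closed, the precision is uniform over the vertices but may grow with the graph.
    Multiplying by [A] instead of dividing keeps the case [A = 0] harmless. *)
Definition approx X f : Prop := forall A, over pred0 A -> exists u, rep X u /\
  forall G (b : labelling p G) va na,
    Rabs (f G b va - u G b va) * INR (eval_t b A va na) <= 1.

Lemma rep_approx X u : rep X u -> approx X u.
Proof.
by move=> Xu A oA; exists u; split=> // *; rewrite Rminus_diag Rabs_R0; lra.
Qed.

Lemma approx_ext X f g : (forall G (b : labelling p G) va, f G b va = g G b va) ->
  approx X f -> approx X g.
Proof.
move=> fg af A oA; have [u [ru uf]] := af A oA.
by exists u; split=> // G b va na; rewrite -fg.
Qed.

Lemma approx_sub X X' f : subpred X X' -> approx X f -> approx X' f.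
Proof.
move=> XX' af A oA; have [u [[P [N [D [oP oN oD uE]]]] uf]] := af A oA.
by exists u; split=> //; exists P, N, D; split=> //; apply: (over_sub XX').
Qed.

Lemma rep_add X u v : rep X u -> rep X v ->
  rep X (fun G b va => u G b va + v G b va).
Proof.
move=> [P [N [D [oP oN oD uE]]]] [P' [N' [D' [oP' oN' oD' vE]]]].
have cD := over_closed_sub X oD; have cD' := over_closed_sub X oD'.
exists (TAdd (TMul P D') (TMul P' D)), (TAdd (TMul N D') (TMul N' D)), (TMul D D').
split; try by repeat (apply: over_add || apply: over_mul).
move=> G b va na /=; have [D0 ->] := uE G b va na; have [D0' ->] := vE G b va na.
split; first by rewrite muln_gt0 D0.
have := INR_gt0 D0; have := INR_gt0 D0'.
by rewrite !INR_addn !INR_muln => *; field; lra.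
Qed.

Lemma rep_mul X u v : rep X u -> rep X v ->
  rep X (fun G b va => u G b va * v G b va).
Proof.
move=> [P [N [D [oP oN oD uE]]]] [P' [N' [D' [oP' oN' oD' vE]]]].
exists (TAdd (TMul P P') (TMul N N')), (TAdd (TMul P N') (TMul N P')), (TMul D D').
split; try by repeat (apply: over_add || apply: over_mul).
move=> G b va na /=; have [D0 ->] := uE G b va na; have [D0' ->] := vE G b va na.
split; first by rewrite muln_gt0 D0.
have := INR_gt0 D0; have := INR_gt0 D0'.
by rewrite !INR_addn !INR_muln => *; field; lra.
Qed.

Lemma INR_to_nat z : IZR z = INR (Z.to_nat z) - INR (Z.to_nat (- z)).
Proof. by rewrite !INR_IZR_INZ -minus_IZR; congr IZR; lia. Qed.

Lemma rep_dyadic X a : dyadic a -> rep X (fun G b va => a).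
Proof.
case=> z [k ->].
exists (tnat p (Z.to_nat z)), (tnat p (Z.to_nat (- z))), (tnat p (2 ^ k)%N).
split; try exact: over_nat.
move=> G b va na; rewrite !eval_nat expn_gt0; split=> //.
rewrite -INR_to_nat; congr (_ / _).
by elim: k => //= k IH; rewrite expnS INR_muln IH.
Qed.

Lemma rep_relu X u : rep X u -> rep X (fun G b va => Rmax 0 (u G b va)).
Proof.
move=> [P [N [D [oP oN oD uE]]]]; exists (tsub P N), TZero, D.
split=> //; first exact: over_tsub.
move=> G b va na; have [D0 ->] := uE G b va na; split=> //.
rewrite (eval_tsub oP oN) /=.
have iD := Rinv_0_lt_compat _ (INR_gt0 D0).
rewrite Rminus_0_r; case: (leqP (eval_t b N va na) (eval_t b P va na)) => NP.
  have NP' := INR_leq NP; rewrite INR_subn // Rmax_right //.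
  by apply: Rmult_le_pos; lra.
have PN' := INR_leq (ltnW NP); have -> : (eval_t b P va na - eval_t b N va na = 0)%N.
  by apply/eqP; rewrite subn_eq0 ltnW.
rewrite Rmax_left /= /Rdiv; first lra.
have := Rmult_le_compat_r (/ INR (eval_t b D va na)) _ 0 (Rlt_le _ _ iD) _.
by rewrite Rmult_0_l; apply; lra.
Qed.

(** The mean needs no case for the empty list: its sum is 0, and [0 / r] is 0 for every [r]. *)
Definition agg1 ag (s : seq R) : R :=
  match ag, s with
  | AggSum, _ => foldr Rplus 0 s
  | AggMean, _ => foldr Rplus 0 s / INR (size s)
  | AggMax, [::] => 0
  | AggMax, m :: s' => foldr Rmax m s'
  end.

Lemma aggregate_agg1 ag (T : Type) (h : T -> nat -> R) s j :
  aggregate ag [seq h w | w <- s] j = agg1 ag [seq h w j | w <- s].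
Proof.
have foldE (op : R -> R -> R) z r :
  foldr (fun m acc => op (m j) acc) z [seq h w | w <- r]
  = foldr op z [seq h w j | w <- r] by elim: r => //= w r ->.
case: ag; case: s => [|w s] //=; rewrite ?foldE ?size_map //.
by rewrite Rdiv_0_l.
Qed.

Definition nbr_agg ag i f : real_expr := fun G b va =>
  agg1 ag [seq f G b (vupd va (~~ i) w) | w <- nbrs (va i)].

Lemma rep_nbr_sum i u : rep predT u -> rep (pred1 i) (nbr_agg AggSum i u).
Proof.
move=> [P [N [D [oP oN oD uE]]]]; exists (tnbr_sum i P), (tnbr_sum i N), D.
split; try exact: over_nbr_sum; first by [].
move=> G b va na; split; first exact: (uE G b va na).1.
rewrite !eval_nbr_sum /nbr_agg /=.
elim: (nbrs (va i)) => [|w s IH] /=; first by rewrite Rminus_diag Rdiv_0_l.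
have [_ ->] := uE G b (vupd va (~~ i) w) na.
by rewrite IH (over_closed oD b (vupd va (~~ i) w) va na na) !INR_addn; lra.
Qed.

(** A nondecreasing map commutes with maxima; this carries the maximum of natural numerators over to
    the reals. *)
Lemma foldr_Rmax_mono (phi : nat -> R) :
  (forall m n, (m <= n)%N -> phi m <= phi n) ->
  forall n s, foldr Rmax (phi n) (map phi s) = phi (foldr maxn n s).
Proof.
move=> mono n; elim=> //= m s ->.
case: (leqP m (foldr maxn n s)) => ms; first by rewrite Rmax_right //; apply: mono.
by rewrite Rmax_left //; apply/mono/ltnW.
Qed.

Lemma rep_nbr_max i u : rep predT u -> rep (pred1 i) (nbr_agg AggMax i u).
Proof.
move=> [P [N [D [oP oN oD uE]]]]; exists (tnbr_max i P N), (tnbr_sum i N), D.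
split; [exact: over_nbr_max|exact: over_nbr_sum|by []|].
move=> G b va na; have [D0 _] := uE G b va na; split=> //.
rewrite eval_nbr_max // /nbr_agg; set B := eval_t b (tnbr_sum i N) va na.
have BN w : w \in nbrs (va i) -> (eval_t b N (vupd va (~~ i) w) na <= B)%N.
  by move=> ws; rewrite /B eval_nbr_sum sumnE big_map (big_rem w) //= leq_addr.
(* [phi] undoes the shift by [B] built into [tnbr_max] and divides by the common denominator. *)
pose phi n := (INR n - INR B) / INR (eval_t b D va na).
have mono m n : (m <= n)%N -> phi m <= phi n.
  have := Rinv_0_lt_compat _ (INR_gt0 D0).
  by move=> ? /INR_leq mn; apply: Rmult_le_compat_r; lra.
have phiE : [seq u G b (vupd va (~~ i) w) | w <- nbrs (va i)] =
    [seq phi n | n <- [seq (eval_t b P (vupd va (~~ i) w) na + B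
                - eval_t b N (vupd va (~~ i) w) na)%N | w <- nbrs (va i)]].
  rewrite -map_comp; apply/eq_in_map => w /BN ws /=.
  have [_ ->] := uE G b (vupd va (~~ i) w) na.
  rewrite (over_closed oD b (vupd va (~~ i) w) va na na) /phi.
  rewrite INR_subn; first by rewrite INR_addn; congr (_ / _); ring.
  exact: leq_trans ws (leq_addl _ _).
rewrite phiE /= {phiE}; case E : (nbrs (va i)) => [|w s] /=.
  (* Without neighbours both numerators are 0, in accordance with the default value of the
     maximum. *)
  by rewrite /B eval_nbr_sum E Rminus_diag Rdiv_0_l.
by rewrite foldr_Rmax_mono.
Qed.

(** * Propagation of approximation errors *)

Lemma approx_add X f g : approx X f -> approx X g ->
  approx X (fun G b va => f G b va + g G b va).
Proof.
(* Each summand is requested with precision [2A], so that the two errors together stay within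
   [1 / A]. *)
move=> af ag A oA; have o2A : over pred0 (TAdd A A) by exact: over_add.
have [u [ru uf]] := af _ o2A; have [v [rv vg]] := ag _ o2A.
exists (fun G b va => u G b va + v G b va); split; first exact: rep_add.
move=> G b va na; have := uf G b va na; have := vg G b va na.
rewrite /= INR_addn; set a := INR _; have a0 : 0 <= a by exact: pos_INR.
move=> vg' uf'; have := Rabs_triang (f G b va - u G b va) (g G b va - v G b va).
have -> : f G b va - u G b va + (g G b va - v G b va)
        = f G b va + g G b va - (u G b va + v G b va) by ring.
by move=> /(Rmult_le_compat_r a _ _ a0); lra.
Qed.

Lemma approx_scale X a f : dyadic a -> approx X f ->
  approx X (fun G b va => a * f G b va).
Proof.
(* Scaling multiplies the error by [|a|], so precision [m * A] is requested with a natural number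
   [m >= |a|]. *)
move=> da af A oA; have [m am] : exists m, Rabs a <= INR m.
  by have [m ?] := INR_unbounded (Rabs a); exists m; lra.
have [u [ru uf]] := af (TMul (tnat p m) A) (over_mul (over_nat p pred0 m) oA).
exists (fun G b va => a * u G b va); split.
  exact: rep_mul (rep_dyadic _ da) ru.
move=> G b va na; apply: Rle_trans (uf G b va na).
rewrite -Rmult_minus_distr_l Rabs_mult /= eval_nat INR_muln -Rmult_assoc.
apply: Rmult_le_compat_r; first exact: pos_INR.
by rewrite Rmult_comm; apply: Rmult_le_compat_l => //; exact: Rabs_pos.
Qed.

Lemma approx_dyadic X a : dyadic a -> approx X (fun G b va => a).
Proof. by move=> /(rep_dyadic X)/rep_approx. Qed.

(** The maximum is nonexpansive: its error is at most the larger of the two argument errors. *)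
Lemma Rmax_dist x x' y y' a : Rabs (x - y) * a <= 1 -> Rabs (x' - y') * a <= 1 ->
  0 <= a -> Rabs (Rmax x x' - Rmax y y') * a <= 1.
Proof.
move=> xy xy' a0.
have : Rabs (Rmax x x' - Rmax y y') <= Rabs (x - y) \/
       Rabs (Rmax x x' - Rmax y y') <= Rabs (x' - y').
  by rewrite /Rmax; do 2!case: Rle_dec => ?; split_Rabs; lra.
by case=> /(Rmult_le_compat_r a _ _ a0); lra.
Qed.

Lemma approx_relu X f : approx X f -> approx X (fun G b va => Rmax 0 (f G b va)).
Proof.
move=> af A oA; have [u [ru uf]] := af A oA.
exists (fun G b va => Rmax 0 (u G b va)); split; first exact: rep_relu.
move=> G b va na; apply: Rmax_dist => //; last exact: pos_INR.
by rewrite Rminus_diag Rabs_R0; lra.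
Qed.

Lemma approx_nbr_sum i f : approx predT f -> approx (pred1 i) (nbr_agg AggSum i f).
Proof.
(* Errors add up over at most [gn G] neighbours, hence the requested precision [A * ord]. *)
move=> af A oA; have oA' := over_mul oA (over_ord p pred0).
have [u [ru uf]] := af _ oA'.
exists (nbr_agg AggSum i u); split; first exact: rep_nbr_sum.
move=> G b va na; rewrite /nbr_agg /=.
have n0 : 0 < INR (gn G) by exact/INR_gt0/gn_pos.
set a := INR _.
suff : Rabs (foldr Rplus 0 [seq f G b (vupd va (~~ i) w) | w <- nbrs (va i)] -
   foldr Rplus 0 [seq u G b (vupd va (~~ i) w) | w <- nbrs (va i)]) * a * INR (gn G)
   <= INR (size (nbrs (va i))).
  have : (size (nbrs (va i)) <= gn G)%N.
    by rewrite size_filter (leq_trans (count_size _ _)) // size_enum_ord.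
  by move=> /INR_leq; nra.
elim: (nbrs (va i)) => [|w s IH]; first by rewrite /= Rminus_diag Rabs_R0; lra.
have := uf G b (vupd va (~~ i) w) na; rewrite /= INR_muln.
rewrite (over_closed oA b (vupd va (~~ i) w) va na na) -/a => wE.
rewrite -/(INR (size s).+1) S_INR.
move: IH; set F := foldr _ _ _; set U := foldr _ _ _ => IH.
have := Rabs_triang (f G b (vupd va (~~ i) w) - u G b (vupd va (~~ i) w)) (F - U).
have -> : f G b (vupd va (~~ i) w) - u G b (vupd va (~~ i) w) + (F - U)
   = f G b (vupd va (~~ i) w) + F - (u G b (vupd va (~~ i) w) + U) by ring.
have an : 0 <= a * INR (gn G) by apply: Rmult_le_pos; [exact: pos_INR|lra].
by move=> /(Rmult_le_compat_r _ _ _ an); lra.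
Qed.

Lemma approx_nbr_max i f : approx predT f -> approx (pred1 i) (nbr_agg AggMax i f).
Proof.
move=> af A oA; have [u [ru uf]] := af A oA.
exists (nbr_agg AggMax i u); split; first exact: rep_nbr_max.
move=> G b va na; rewrite /nbr_agg; set a := INR _.
have a0 : 0 <= a by exact: pos_INR.
have d w : Rabs (f G b (vupd va (~~ i) w) - u G b (vupd va (~~ i) w)) * a <= 1.
  have := uf G b (vupd va (~~ i) w) na.
  by rewrite (over_closed oA b (vupd va (~~ i) w) va na na).
case: (nbrs (va i)) => [|w s] /=; first by rewrite Rminus_diag Rabs_R0; lra.
by elim: s => [|w' s IH] //=; exact: Rmax_dist.
Qed.

(* Numerators are multiplied by [A + 1] before the floor division; this is the
   only operation that rounds. *)
Lemma rep_div X u t d : rep X u -> over X t ->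
  (forall G (b : labelling p G) va na, d G b va = eval_t b t va na) ->
  approx X (fun G b va => u G b va / INR (d G b va)).
Proof.
move=> [P [N [D [oP oN oD uE]]]] ot dE A oA.
pose A1 := TAdd A TOne; have oA1 : over pred0 A1 by exact: over_add.
have oXA1 := over_closed_sub X oA1.
have oAP := over_mul oXA1 oP; have oAN := over_mul oXA1 oN.
have ov : over X (tdiv (TMul A1 P) t) /\ over X (tdiv (TMul A1 N) t).
  by split; exact: over_tdiv.
(* A [real_expr] carries no number assignment; any fixed one works, as the terms have no free number
   variables. *)
pose na0 : nat -> nat := fun=> 0%N.
exists (fun G b va => (INR (eval_t b (tdiv (TMul A1 P) t) va na0)
    - INR (eval_t b (tdiv (TMul A1 N) t) va na0))
    / INR (eval_t b (TMul A1 D) va na0)); split.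
  exists (tdiv (TMul A1 P) t), (tdiv (TMul A1 N) t), (TMul A1 D).
  split; [exact: ov.1|exact: ov.2|exact: over_mul|] => G b va na.
  split; first by rewrite /= muln_gt0 addn1 (uE G b va na).1.
  rewrite (over_eval ov.1 (va' := va) b _ na) // (over_eval ov.2 (va' := va) b _ na) //.
  by rewrite (over_closed (over_mul oA1 oD) b va va na0 na).
move=> G b va na; have [D0 ->] := uE G b va na0; rewrite (dE _ _ _ na0).
rewrite !(eval_tdiv oAP ot) !(eval_tdiv oAN ot) /= (over_closed oA b va va na na0).
set a := eval_t b A _ _; set P' := eval_t b P _ _; set N' := eval_t b N _ _.
set g := eval_t b t _ _; set D' := eval_t b D _ _ in D0 *.
have D1 : 1 <= INR D' by exact: (INR_leq D0).
have a0 : 0 <= INR a by exact: pos_INR.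
case: (posnP g) => [->|g0].
  by rewrite !divn0 /= Rminus_diag Rdiv_0_l Rdiv_0_r Rminus_diag Rabs_R0; lra.
have g0' := INR_gt0 g0.
have := INR_divn_bounds ((a + 1) * P') g0; have := INR_divn_bounds ((a + 1) * N') g0.
rewrite !INR_muln INR_addn /=.
set p' := INR ((a + 1) * P' %/ g); set n' := INR ((a + 1) * N' %/ g) => bn bp.
(* Each floor division loses at least 0 and less than [g], so the difference of the losses over [g]
   is at most 1 in absolute value; the denominator [(a + 1) * D'] exceeds [a]. *)
have -> : (INR P' - INR N') / INR D' / INR g - (p' - n') / ((INR a + 1) * INR D')
  = ((((INR a + 1) * INR P' - p' * INR g) - ((INR a + 1) * INR N' - n' * INR g))
    / INR g) / ((INR a + 1) * INR D') by field; lra.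
set y := _ / INR g; set q := _ * INR D'.
have y1 : Rabs y <= 1.
  suff : - INR g <= y * INR g <= INR g by move=> ?; split_Rabs; nra.
  by rewrite /y /Rdiv Rmult_assoc Rinv_l; lra.
have aq : INR a <= q by rewrite /q; nra.
have q0 : 0 < q by rewrite /q; nra.
rewrite /Rdiv Rabs_mult Rabs_inv (Rabs_pos_eq q); last lra.
apply: (Rmult_le_reg_r q) => //.
have -> : Rabs y * / q * INR a * q = Rabs y * INR a by field; lra.
by nra.
Qed.

(** Half of the error comes from [u] in place of [f], half from rounding. Dividing by a natural
    number does not enlarge the former: it is at least 1, or both quotients are 0. *)
Lemma approx_div X f t d : approx X f -> over X t ->
  (forall G (b : labelling p G) va na, d G b va = eval_t b t va na) ->
  approx X (fun G b va => f G b va / INR (d G b va)).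
Proof.
move=> af ot dE A oA; have o2A : over pred0 (TAdd A A) by exact: over_add.
have [u [ru uf]] := af _ o2A; have [v [rv vg]] := rep_div ru ot dE o2A.
exists v; split=> // G b va na; have := uf G b va na; have := vg G b va na.
rewrite /= INR_addn; set a := INR (eval_t _ _ _ _).
have a0 : 0 <= a by exact: pos_INR.
set n := d G b va => uv fu.
have : Rabs (f G b va / INR n - u G b va / INR n) <= Rabs (f G b va - u G b va).
  case: (posnP n) => [->|/INR_leq n1].
    by rewrite !Rdiv_0_r Rminus_diag Rabs_R0; exact: Rabs_pos.
  rewrite -Rdiv_minus_distr /Rdiv Rabs_mult Rabs_inv.
  rewrite (Rabs_pos_eq (INR n)); last exact: pos_INR.
  rewrite /= in n1; apply: (Rmult_le_reg_r (INR n)); first lra.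
  rewrite Rmult_assoc Rinv_l; last lra.
  by have := Rabs_pos (f G b va - u G b va); nra.
move=> /(Rmult_le_compat_r a _ _ a0).
have := Rabs_triang (f G b va / INR n - u G b va / INR n) (u G b va / INR n - v G b va).
have -> : f G b va / INR n - u G b va / INR n + (u G b va / INR n - v G b va)
        = f G b va / INR n - v G b va by ring.
by move=> /(Rmult_le_compat_r a _ _ a0); lra.
Qed.

Lemma approx_nbr_agg ag i f : approx predT f -> approx (pred1 i) (nbr_agg ag i f).
Proof.
case: ag => af; [exact: approx_nbr_sum| |exact: approx_nbr_max].
(* The degree is the neighbour sum of the constant 1. It varies with the vertex, so it cannot join
   the closed denominator and goes through [approx_div]. *)
have odeg := over_nbr_sum i (over1 p predT).
apply: approx_ext (approx_div (approx_nbr_sum i af) odeg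
  (d := fun G b va => size (nbrs (va i))) _) => [G b va|G b va na].
  by rewrite /nbr_agg /= size_map.
by rewrite eval_nbr_sum /=; elim: (nbrs _) => //= w s ->.
Qed.

(** * Piecewise linear activations as sums of ReLUs *)

Lemma dyadic_sub a c : dyadic a -> dyadic c -> dyadic (a - c).
Proof.
move=> [z [k ->]] [z' [k' ->]]; exists (z * 2 ^ Z.of_nat k' - z' * 2 ^ Z.of_nat k)%Z, (k + k')%N.
rewrite minus_IZR !mult_IZR -!pow_IZR pow_add.
have := pow_lt 2 k ltac:(lra); have := pow_lt 2 k' ltac:(lra).
by move=> *; field; lra.
Qed.

Lemma dyadic_IZR z : dyadic (IZR z).
Proof. by exists z, 0%N; rewrite /= Rdiv_1_r. Qed.

(** Start from the leftmost piece and add the change of slope at each threshold. The constant terms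
    then match because both adjacent pieces are valid at the threshold ([glue]). *)
Lemma pl_relu_sum L m (t a c : nat -> R) : pl_minimal_repr L m t a c -> forall x,
  L x = a 0%N * x + c 0%N + sumR m (fun i => (a i.+1 - a i) * Rmax 0 (x - t i)).
Proof.
case=> tlt [_ piece].
pose g j x := a 0%N * x + c 0%N + sumR j (fun i => (a i.+1 - a i) * Rmax 0 (x - t i)).
have gS j x : g j.+1 x = g j x + (a j.+1 - a j) * Rmax 0 (x - t j).
  by rewrite /g /=; ring.
have tle j : (0 < j < m)%N -> t j.-1 <= t j.
  by case: j => //= j jm; have := tlt j jm; lra.
have glue j : (j < m)%N -> a j * t j + c j = a j.+1 * t j + c j.+1.
  move=> jm; have jm' := ltnW jm.
  rewrite -(piece j) //; [|by case: (posnP j) => [->|j0]; [left|right; apply: tle; rewrite j0]|by right; lra].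
  rewrite -(piece j.+1) //; first by right => /=; lra.
  case: (ltngtP j.+1 m) => [jm1|jm1|]; [by right; have := tlt j jm1; lra| |by left].
  by move: jm1; rewrite ltnS leqNgt jm.
(* To the right of the threshold with index [j - 1], the first [j] ReLUs are all in their linear
   range. *)
have gE j x : (j <= m)%N -> (j = 0%N \/ t j.-1 <= x) -> g j x = a j * x + c j.
  elim: j => [|j IH] jm; first by rewrite /g /=; lra.
  case=> //= tx; rewrite gS Rmax_right; last lra.
  rewrite IH; [|exact: ltnW|].
    by have := glue j jm; nra.
  case: (posnP j) => [->|j0]; [by left|right].
  by have := tle j; rewrite j0 jm => /(_ isT); lra.
move=> x; suff : forall j, (j <= m)%N -> (j = m \/ x <= t j) -> L x = g j x.
  by apply; [exact: leqnn|left].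
elim=> [|j IH] jm xt.
  by rewrite (piece 0%N) //; [rewrite /g /=; lra|left].
case: (Rle_lt_dec (t j) x) => tx.
  by rewrite gE //; [apply: piece => //; right|right].
rewrite gS Rmax_left; last lra.
by rewrite (IH (ltnW jm)); [lra|right; lra].
Qed.

Lemma approx_sumR X n (f : nat -> real_expr) :
  (forall i, (i < n)%N -> approx X (f i)) ->
  approx X (fun G b va => sumR n (fun i => f i G b va)).
Proof.
elim: n => [|n IH] af /=; first exact: approx_dyadic (dyadic_IZR 0).
by apply: approx_add; [apply: IH => i /leqW|]; exact: af.
Qed.

Lemma approx_act X L f : cont_rat_pl L -> approx X f ->
  approx X (fun G b va => L (f G b va)).
Proof.
case=> _ [m [t [a [c [Lr [dt dac]]]]]] af.
apply: (@approx_ext _ (fun G b va => a 0%N * f G b va + c 0%N +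
   sumR m (fun i => (a i.+1 - a i) * Rmax 0 (f G b va - t i)))).
  by move=> G b va; rewrite (pl_relu_sum Lr).
have [da dc] := dac 0%N isT.
apply: approx_add.
  by apply: approx_add; [exact: approx_scale|exact: approx_dyadic].
apply: approx_sumR => i im; apply: approx_scale.
  by apply: dyadic_sub; apply dac => //; exact: ltnW.
apply: approx_relu; apply: approx_add => //; apply: approx_dyadic.
by rewrite -Rminus_0_l; apply: dyadic_sub; [exact: dyadic_IZR|exact: dt].
Qed.

(** * Networks, layers and whole GNNs *)

Lemma approx_fnn X (F : fnn) (x : nat -> real_expr) : fnn_rat_pl F ->
  (forall i, (i < fn_nin F)%N -> approx X (x i)) ->
  forall j, approx X (fun G b va => fnn_eval F (fun i => x i G b va) j).
Proof.
move=> [dw dba] ax j; rewrite /fnn_eval.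
move: (fn_outnode F j) (leqnn (fn_size F)).
elim: {1 3}(fn_size F) => [|k IH] v /= ksz; first exact: approx_dyadic (dyadic_IZR 0).
case: (v == k); last exact: IH (ltnW ksz).
case: (ltnP k (fn_nin F)) => kin; first exact: ax.
have [db ca] := dba k kin ksz.
apply: approx_act => //; apply: approx_add; first exact: approx_dyadic.
(* The edge test stays inside the summand: weights are known to be dyadic only along edges. *)
refine (@approx_sumR X k (fun w G b va => if fn_edge F w k then
  fn_w F w k * fnn_vals F (fun i => x i G b va) k w else 0) _) => w _.
case E : (fn_edge F w k); last exact: approx_dyadic (dyadic_IZR 0).
by apply: approx_scale; [exact: dw|exact: IH (ltnW ksz)].
Qed.

Definition signal := forall G : graph, labelling p G -> 'I_(gn G) -> nat -> R.

(** Both vertex variables are covered, because a message reads the signal of the neighbour through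
    the other variable. *)
Definition approx_signal n (S : signal) : Prop := forall i j, (j < n)%N ->
  approx (pred1 i) (fun G b va => S G b (va i) j).

Lemma approx_vcat X n m (f g : nat -> real_expr) :
  (forall j, (j < n)%N -> approx X (f j)) ->
  (forall j, (j < m)%N -> approx X (g j)) ->
  forall j, (j < n + m)%N -> approx X (fun G b va =>
    vcat n (fun k => f k G b va) (fun k => g k G b va) j).
Proof.
move=> af ag j jnm; rewrite /vcat; case: (ltnP j n) => jn; first exact: af.
by apply: ag; rewrite ltn_subLR.
Qed.

(** The message may use both vertex variables; aggregation binds the one naming the neighbour. Only
    [x_i] remains free, so two variables suffice for any depth. *)
Lemma approx_layer l (S : signal) :
  layer_wf l -> fnn_rat_pl (ly_msg l) -> fnn_rat_pl (ly_comb l) ->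
  approx_signal (ly_in l) S ->
  approx_signal (ly_out l) (fun G b => layer_apply l (S G b)).
Proof.
move=> [_ [_ [msg_in comb_in]]] rm rc aS i j _.
pose msg k : real_expr := fun G b va =>
  fnn_eval (ly_msg l) (vcat (ly_in l) (S G b (va i)) (S G b (va (~~ i)))) k.
have amsg k : approx predT (msg k).
  pose x k' : real_expr := fun G b va =>
    vcat (ly_in l) (S G b (va i)) (S G b (va (~~ i))) k'.
  apply: (@approx_fnn _ _ x) => // k'; rewrite msg_in mul2n -addnn.
  by apply: approx_vcat => k'' ?; apply: (approx_sub (X := pred1 _)) => //; exact: aS.
pose y k : real_expr := fun G b va =>
  vcat (ly_in l) (S G b (va i)) (fun k' => nbr_agg (ly_agg l) i (msg k') b va) k.
apply: (@approx_ext _ (fun G b va => fnn_eval (ly_comb l) (fun k => y k G b va) j)).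
  move=> G b va; rewrite /layer_apply; congr fnn_eval.
  apply: functional_extensionality => k; rewrite /y /vcat; case: ifP => // _.
  rewrite aggregate_agg1 /nbr_agg; congr agg1; apply: eq_map => w.
  by rewrite /msg /vupd eqxx; case: (i).
apply: approx_fnn => // k; rewrite comb_in.
apply: approx_vcat => k' ?; first exact: aS.
exact: approx_nbr_agg.
Qed.

Lemma approx_gnn N n q (S : signal) : gnn_wf N n q -> gnn_rat_pl N ->
  approx_signal n S -> approx_signal q (fun G b => gnn_apply N (S G b)).
Proof.
elim: N n S => [|l N IH] n S /=; first by move=> ->.
move=> [<- [wl wN]] rN aS; have [rm rc] := rN l (or_introl erefl).
apply: (IH _ (fun G b => layer_apply l (S G b))) wN _ _.
  by move=> l' l'N; apply: rN; right.
exact: approx_layer.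
Qed.

Lemma approx_lab_signal : approx_signal p (fun G b => lab_signal b).
Proof.
move=> i j jp; apply: rep_approx.
(* A count that binds no variable is the truth value of its formula. *)
exists (TCnt (BEnd (FLab (Ordinal jp) i))), TZero, TOne; split=> //.
move=> G b va na; split; rewrite //= /lab_signal (tnth_nth false) /=.
by case: nth => /=; lra.
Qed.

End Approximation.

(** * Rounding the output at the threshold 1/2 *)

Theorem theorem1p4 (p : nat) (Q : query p) :
  query_invariant Q ->
  (exists N : gnn, gnn_wf N p 1 /\ gnn_rat_pl N /\ gnn_computes N Q) ->
  gfoc_definable Q.
Proof.
move=> _ [N [wN [rN NQ]]].
have aN := approx_gnn wN rN (@approx_lab_signal p).
(* Outputs are at distance at least 1/4 from 1/2, so an error of 1/8 cannot move them across. *)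
have [u [[P [T [D [oP oT oD uE]]]] uN]] :=
  aN false 0 isT (tnat p 8) (over_nat p pred0 8).
(* This is [(P - T) / D >= 1/2] with the denominators cleared. *)
exists (FLe (TAdd D (TAdd T T)) (TAdd P P)); split.
  by rewrite /=; apply/negP => /orP[/or3P[/(proj1 oD)|/(proj1 oT)|/(proj1 oT)]|/orP[/(proj1 oP)|/(proj1 oP)]].
split=> [y|G b v va na vE]; first by rewrite /= oP.2 oT.2 oD.2.
have [yes no] := NQ G b v.
have := uN G b va na; have [D0 ->] := uE G b va na.
rewrite eval_nat vE /=; have D1 := INR_gt0 D0.
set P' := eval_t b P va na; set T' := eval_t b T va na; set D' := eval_t b D va na in D1 *.
set r := gnn_apply _ _ _ _ in yes no * => err.
set z := ((INR P' - INR T') / INR D')%Re in err.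
have zE : (INR P' - INR T' = z * INR D')%Re by rewrite /z; field; lra.
have ez : (-1/8 <= r - z <= 1/8)%Re by move: err; split_Rabs; lra.
apply/idP/idP => H.
  apply/negPn/negP => /no rle; have := INR_leq H; rewrite !INR_addn => H'.
  by nra.
rewrite leqNgt; apply/negP => H'; have := INR_leq (ltnW H').
rewrite !INR_addn; have := yes H; nra.
Qed.
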